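(* Let $\mathcal{S}=\overline{\mathbb{Z}}_{\max}[\![\gamma]\!]$, and let $A\in\mathcal{S}^{n\times n}$, $B\in\mathcal{S}^{n\times p}$, $C\in\mathcal{S}^{m\times n}$, $R\in\mathcal{S}^{n\times l}$ be the matrices of a system satisfying the standing assumptions in the context. Let $\overline{B}=\begin{pmatrix}B & R\end{pmatrix}\in\mathcal{S}^{n\times(p+l)}$ and $$L_x=\big((A^\ast B)/(CA^\ast B)\big)\wedge\big((A^\ast R)/(CA^\ast R)\big).$$ For $u\in\mathcal{S}^p$, $w\in\mathcal{S}^l$ let $x=A^\ast Bu\oplus A^\ast Rw$ be the state, i.e. the least solution of $x=Ax\oplus Bu\oplus Rw$, let $y=Cx$, and let $\hat{x}$ be the estimated state obtained with the observer matrix $L_x$, i.e. the least solution of $\hat{x}=A\hat{x}\oplus Bu\oplus L_x(C\hat{x}\oplus y)$. If $A^\ast\overline{B}$ belongs to the image of the map $\Psi_{CA^\ast\overline{B}}:z\mapsto z\otimes CA^\ast\overline{B}$, i.e. if there exists $z\in\mathcal{S}^{n\times m}$ with $A^\ast\overline{B}=z\,CA^\ast\overline{B}$, then $\hat{x}=x$ for all $(u,w)\in\mathcal{S}^p\times\mathcal{S}^l$.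
   Context: Idempotent semiring. $\overline{\mathbb{Z}}_{\max}=\mathbb{Z}\cup\{-\infty,+\infty\}$ with $\oplus=\max$ and $\otimes=+$ (and $(-\infty)+(+\infty)=-\infty$). $\mathcal{S}=\overline{\mathbb{Z}}_{\max}[\![\gamma]\!]$ is the set of formal series $s=\bigoplus_{k\in\mathbb{Z}}s(k)\gamma^k$, $s(k)\in\overline{\mathbb{Z}}_{\max}$, with coefficientwise sum and Cauchy product, subject to the rule $t\gamma^{n_1}\oplus t\gamma^{n_2}=t\gamma^{\min(n_1,n_2)}$ (i.e. a series is identified with the series with nondecreasing coefficients $k\mapsto\sup_{j\le k}s(j)$). It is a complete idempotent semiring (closed under infinite $\oplus$-sums, over which $\otimes$ distributes) with zero $\varepsilon$ (absorbing) and unit $e=0\gamma^0$. Order: $a\succeq b\iff a=a\oplus b$; $\wedge$ is the greatest lower bound. $\otimes$ is often omitted. Matrices. Sum, product, order and $\wedge$ of matrices are the usual ones built from the scalar ones (sum, order and $\wedge$ are entrywise); $e$ also denotes the identity matrix. For a square matrix $M$, $M^\ast=\bigoplus_{i\in\mathbb{N}}M^i$ with $M^0=e$; the least solution of $x=Mx\oplus b$ is $M^\ast b$. For matrices $P\in\mathcal{S}^{n\times q}$ and $Q\in\mathcal{S}^{m\times q}$, $P/Q\in\mathcal{S}^{n\times m}$ denotes the greatest matrix $X$ with $XQ\preceq P$ (right residuation). Standing assumptions on the system. Each column of $B$ (resp. $R$) has exactly one entry equal to $e$, the others being $\varepsilon$, and each row has at most one entry equal to $e$. Each row of $C$ has exactly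 one entry equal to $e$, the others being $\varepsilon$, and each column has at most one entry equal to $e$. *)

(* Defs.v *)
From HB Require Import structures.
From mathcomp Require Import all_boot all_order all_algebra.
From mathcomp Require Import boolp classical_sets constructive_ereal.
From mathcomp Require Import zify.

Set Implicit Arguments.
Unset Strict Implicit.
Unset Printing Implicit Defensive.

Import Order.TTheory GRing.Theory Num.Theory.

Local Open Scope classical_set_scope.
Local Open Scope ring_scope.

(* In [\bar int] the library addition satisfies -oo + +oo = -oo, so -oo is
   absorbing for the product of the max-plus dioid. *)
Definition zmax : Type := \bar int.

Definition zsup (A : set zmax) : zmax := supremum (-oo%E : zmax) A.

Lemma zsup_le (A : set zmax) (c : zmax) :
  (zsup A <= c)%E <-> (forall x, A x -> (x <= c)%E).
Proof.
suff [s [ubs les]] : supremums A !=set0.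
  have -> : zsup A = s.
    rewrite /zsup /supremum; case: ifPn => [/eqP A0|_].
      apply/eqP; rewrite eq_le leNye /=; apply: les => x.
      by rewrite A0.
    case: xgetP => [t _ At|/(_ s)]; last by move=> /(_ (conj ubs les)).
    exact: (is_subset1_supremums At (conj ubs les)).
  split=> [sc x Ax|]; last exact: les.
  exact: le_trans (ubs _ Ax) sc.
have [[b bA]|nb] := pselect (exists b : int, forall x, A x -> (x <= b%:E)%E);
    last first.
  exists +oo%E; split=> [x _|y yA]; first exact: leey.
  case: y yA => [q| |] yA; [by case: nb; exists q|by []|].
  by case: nb; exists 0 => x Ax; apply: le_trans (yA _ Ax) _; exact: leNye.
have [[r Ar]|nr] := pselect (exists r : int, A r%:E); last first.
  exists -oo%E; split=> [x Ax|y _]; last exact: leNye.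
  case: x Ax => [q| |//] Ax; first by case: nr; exists q.
  exact: (bA _ Ax).
pose P (k : nat) := `[< forall x, A x -> (x <= (r + k%:Z)%:E)%E >].
have exP : exists k, P k.
  exists `|b - r|%N; apply/asboolP => x Ax; apply: le_trans (bA _ Ax) _.
  by rewrite lee_fin; lia.
case: (ex_minnP exP) => k /asboolP kA kmin.
exists (r + k%:Z)%:E; split=> // y yA.
case: y yA => [q| |] yA; last 2 first.
- exact: leey.
- by have := yA _ Ar.
have rq : r <= q by rewrite -lee_fin; exact: yA.
have : P `|q - r|%N.
  apply/asboolP => x Ax; apply: le_trans (yA _ Ax) _.
  by rewrite lee_fin; lia.
by move=> /kmin; rewrite lee_fin; lia.
Qed.

Lemma zsup_ub (A : set zmax) x : A x -> (x <= zsup A)%E.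
Proof. exact: (zsup_le A _).1 (lexx _) x. Qed.

Lemma zsup_addr_le (A : set zmax) (c d : zmax) :
  (zsup A + c <= d)%E <-> (forall x, A x -> (x + c <= d)%E).
Proof.
split=> [H x Ax|H].
  by apply: le_trans H; apply: leeD => //; exact: zsup_ub.
case: c H => [c| |] H; last by rewrite addeNy leNye.
  rewrite -leeBrDr //; apply/zsup_le => x Ax.
  by rewrite leeBrDr //; exact: H.
have [->|dN] := eqVneq d +oo%E; first exact: leey.
have /zsup_le : forall x, A x -> (x <= -oo)%E.
  by move=> [x| |] // /H; rewrite ?addye ?leye_eq // => /eqP e; rewrite e in dN.
by rewrite leeNy_eq => /eqP ->; rewrite addNye leNye.
Qed.

(* A series modulo t g^n1 (+) t g^n2 = t g^(min n1 n2) is represented by its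
   unique nondecreasing representative. *)
Record maxser : Type := MaxSer {
  coef :> int -> zmax;
  coef_nd : forall j k : int, j <= k -> (coef j <= coef k)%E }.

Lemma maxser_eqP (a b : maxser) : (forall k, a k = b k) -> a = b.
Proof.
case: a b => [a ha] [b hb] /= /funext ab; move: ha hb; rewrite ab => ha hb.
by congr MaxSer; exact: Prop_irrelevance.
Qed.

Lemma canon_subproof (s : int -> zmax) (j k : int) : j <= k ->
  (zsup [set s i | i in [set i : int | (i <= j)%R]]
    <= zsup [set s i | i in [set i : int | (i <= k)%R]])%E.
Proof.
move=> jk; apply/zsup_le => _ [i /= ij <-].
by apply: zsup_ub; exists i => //=; exact: le_trans ij jk.
Qed.

(* the class of an arbitrary formal series *)
Definition canon (s : int -> zmax) : maxser := MaxSer (canon_subproof s).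

Definition sum_coef (s t : int -> zmax) (k : int) : zmax :=
  Order.max (s k) (t k).

Definition cauchy_coef (s t : int -> zmax) (k : int) : zmax :=
  zsup [set (s i + t (k - i)%R)%E | i in [set: int]].

Definition monomial (t : zmax) (n : int) : maxser :=
  canon (fun k => if k == n then t else -oo%E).

Definition ser0 : maxser := canon (fun _ => -oo%E).
Definition ser1 : maxser := monomial 0%E 0.
Definition ser_add (a b : maxser) : maxser := canon (sum_coef a b).
Definition ser_mul (a b : maxser) : maxser := canon (cauchy_coef a b).
Definition ser_sum (F : set maxser) : maxser :=
  canon (fun k => zsup [set a k | a in (F : set maxser)]).
Definition ser_meet (a b : maxser) : maxser :=
  canon (fun k => Order.min (a k) (b k)).

Definition cle (a b : maxser) : Prop := forall k, (a k <= b k)%E.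

Lemma cle_eq (a b : maxser) : (forall c, cle a c <-> cle b c) -> a = b.
Proof.
move=> H; apply: maxser_eqP => k; apply/eqP; rewrite eq_le.
by rewrite ((H b).2 (fun=> lexx _) k) ((H a).1 (fun=> lexx _) k).
Qed.

Lemma canon_cle s (c : maxser) :
  cle (canon s) c <-> (forall k, (s k <= c k)%E).
Proof.
split=> [H k|H k].
  by apply: le_trans (H k); apply: zsup_ub; exists k => /=.
by apply/zsup_le => _ [j /= jk <-]; apply: le_trans (H j) _; exact: coef_nd.
Qed.

Lemma canonK (a : maxser) : canon a = a.
Proof. by apply: cle_eq => c; rewrite canon_cle. Qed.

Lemma ser0_cle c : cle ser0 c.
Proof. by apply/canon_cle => k; exact: leNye. Qed.

Lemma monomial_cle t n c : cle (monomial t n) c <-> (t <= c n)%E.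
Proof.
rewrite canon_cle; split=> [/(_ n)|H k]; first by rewrite eqxx.
by case: eqP => [->|_] //; exact: leNye.
Qed.

Lemma ser_add_cle a b c : cle (ser_add a b) c <-> cle a c /\ cle b c.
Proof.
rewrite canon_cle; split=> [H|[H1 H2] k].
  by split=> k; have := H k; rewrite /sum_coef ge_max => /andP[].
by rewrite /sum_coef ge_max H1 H2.
Qed.

Lemma ser_sum_cle F c : cle (ser_sum F) c <-> (forall a, F a -> cle a c).
Proof.
rewrite canon_cle; split=> [H a Fa k|H k].
  by apply: le_trans (H k); apply: zsup_ub; exists a.
by apply/zsup_le => _ [a Fa <-]; exact: H.
Qed.

Lemma cauchy_le s t (c : int -> zmax) :
  (forall k, (cauchy_coef s t k <= c k)%E) <->
  (forall i j, (s i + t j <= c (i + j)%R)%E).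
Proof.
split=> [H i j|H k].
  apply: le_trans (H (i + j)); apply: zsup_ub; exists i => //=.
  by congr (_ + t _)%E; lia.
by apply/zsup_le => _ [i _ <-]; have := H i (k - i); rewrite [(i + (k - i))%R]addrC subrK.
Qed.

Lemma ser_mul_cle (a b c : maxser) :
  cle (ser_mul a b) c <-> (forall i j, (a i + b j <= c (i + j)%R)%E).
Proof. by rewrite canon_cle cauchy_le. Qed.

Lemma canon_add_le s (t : int -> zmax) (c : maxser) :
  (forall i j, (canon s i + t j <= c (i + j)%R)%E) <->
  (forall i j, (s i + t j <= c (i + j)%R)%E).
Proof.
split=> H i j.
  by apply: (zsup_addr_le _ _ _).1 (H i j) _ _; exists i => /=.
apply/zsup_addr_le => _ [i' /= ii <-]; apply: le_trans (H i' j) _.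
by apply: coef_nd; rewrite lerD2r.
Qed.

Lemma zsum_add_le (s : int -> set zmax) t (c : maxser) :
  (forall i j, (zsup (s i) + t j <= c (i + j)%R)%E) <->
  (forall i j x, s i x -> (x + t j <= c (i + j)%R)%E).
Proof. by split=> H i j; apply/(zsup_addr_le (s i)); exact: H. Qed.

Lemma ser_mulC : commutative ser_mul.
Proof.
move=> a b; apply: cle_eq => c; rewrite !ser_mul_cle.
by split=> H i j; rewrite [(i + j)%R]addrC addeC; exact: H.
Qed.

Lemma ser_mul3_cle a b c d : cle (ser_mul (ser_mul a b) c) d <->
  (forall i j k, (a i + b j + c k <= d (i + j + k)%R)%E).
Proof.
rewrite ser_mul_cle canon_add_le /cauchy_coef zsum_add_le.
split=> [H i j k|H i j _ [l _ <-]].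
  apply: H; exists i => //=; by congr (_ + b _)%E; lia.
by have := H l (i - l) j; rewrite [(l + (i - l))%R]addrC subrK.
Qed.

Lemma ser_mulA : associative ser_mul.
Proof.
move=> a b c; rewrite ser_mulC; apply: cle_eq => d; rewrite !ser_mul3_cle.
split=> H i j k.
  have -> : (i + j + k = j + k + i)%R by lia.
  by rewrite -addeA addeC; exact: H.
have -> : (i + j + k = k + i + j)%R by lia.
by rewrite addeC addeA; exact: H.
Qed.

Lemma ser_mul_sum F b c :
  cle (ser_mul (ser_sum F) b) c <-> (forall a, F a -> cle (ser_mul a b) c).
Proof.
rewrite ser_mul_cle canon_add_le zsum_add_le.
split=> [H a Fa|H i j _ [a Fa <-]]; last exact: (ser_mul_cle _ _ _).1 (H a Fa) i j.
by apply/ser_mul_cle => i j; apply: H; exists a.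
Qed.

Lemma ser_addE a b : ser_add a b = ser_sum [set a; b].
Proof.
apply: cle_eq => c; rewrite ser_add_cle ser_sum_cle.
split=> [[? ?] _ [->|->] //|H]; split; apply: H; [by left|by right].
Qed.

Lemma ser0E : ser0 = ser_sum set0.
Proof. by apply: cle_eq => c; rewrite ser_sum_cle; split=> // _; exact: ser0_cle. Qed.

Lemma ser_mulDl : left_distributive ser_mul ser_add.
Proof.
move=> a b c; apply: cle_eq => d; rewrite ser_add_cle [ser_add a b]ser_addE.
rewrite ser_mul_sum; split=> [H|[? ?] _ [->|->] //].
by split; apply: H; [left|right].
Qed.

Lemma ser_mul0 : left_zero ser0 ser_mul.
Proof.
move=> a; apply: cle_eq => d; rewrite ser0E ser_mul_sum ser_sum_cle.
by split.
Qed.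

Lemma ser_mul1 : left_id ser1 ser_mul.
Proof.
move=> a; apply: cle_eq => d; rewrite ser_mul_cle canon_add_le.
split=> [H j|H i j]; first by have := H 0 j; rewrite eqxx add0e add0r.
by case: eqP => [->|_]; rewrite ?add0e ?add0r ?addNye ?leNye.
Qed.

Lemma ser_addA : associative ser_add.
Proof.
by move=> a b c; apply: cle_eq => d; rewrite !ser_add_cle; tauto.
Qed.

Lemma ser_addC : commutative ser_add.
Proof. by move=> a b; apply: cle_eq => d; rewrite !ser_add_cle; tauto. Qed.

Lemma ser_add0 : left_id ser0 ser_add.
Proof.
move=> a; apply: cle_eq => d; rewrite ser_add_cle.
by split=> [[]|H] //; split=> //; exact: ser0_cle.
Qed.

HB.instance Definition _ := gen_eqMixin maxser.
HB.instance Definition _ := gen_choiceMixin maxser.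
HB.instance Definition _ :=
  GRing.isNmodule.Build maxser ser_addA ser_addC ser_add0.
HB.instance Definition _ := GRing.Nmodule_isComPzSemiRing.Build maxser
  ser_mulA ser_mulC ser_mul1 ser_mulDl ser_mul0.

Definition ser_le (a b : maxser) : bool := b == b + a.

Lemma ser_leP (a b : maxser) : reflect (cle a b) (ser_le a b).
Proof.
apply: (iffP eqP) => [ab|ab].
  by have /ser_add_cle[] : cle (ser_add b a) b by move=> k; rewrite {2}ab.
by apply: cle_eq => c; rewrite ser_add_cle; split=> [H|[]//]; split=> // k;
  exact: le_trans (ab k) (H k).
Qed.

Lemma ser_le_refl : reflexive ser_le.
Proof. by move=> a; apply/ser_leP => k. Qed.

Lemma ser_le_anti : antisymmetric ser_le.
Proof.
move=> a b /andP[/ser_leP ab /ser_leP ba]; apply: maxser_eqP => k.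
by apply/eqP; rewrite eq_le ab ba.
Qed.

Lemma ser_le_trans : transitive ser_le.
Proof.
move=> b a c /ser_leP ab /ser_leP bc; apply/ser_leP => k.
exact: le_trans (ab k) (bc k).
Qed.

Fact maxser_display : Order.disp_t. Proof. by []. Qed.

HB.instance Definition _ := Order.Le_isPOrder.Build maxser_display maxser
  ser_le_refl ser_le_anti ser_le_trans.

Lemma maxser_leP (a b : maxser) : reflect (cle a b) (a <= b)%O.
Proof. exact: ser_leP. Qed.

Lemma ser_meetE (a b : maxser) k : ser_meet a b k = Order.min (a k) (b k).
Proof.
have nd (i j : int) : i <= j -> (Order.min (a i) (b i) <= Order.min (a j) (b j))%O.
  by move=> ij; rewrite le_min !ge_min !coef_nd ?orbT.
exact: (congr1 (fun s : maxser => s k) (canonK (MaxSer nd))).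
Qed.

Lemma maxser_lexI (c a b : maxser) :
  (c <= ser_meet a b)%O = (c <= a)%O && (c <= b)%O.
Proof.
apply/maxser_leP/andP => [H|[/maxser_leP H1 /maxser_leP H2] k].
  by split; apply/maxser_leP => k; have := H k; rewrite ser_meetE le_min => /andP[].
by rewrite ser_meetE le_min H1 H2.
Qed.

Lemma maxser_leUx (a b c : maxser) :
  (a + b <= c)%O = (a <= c)%O && (b <= c)%O.
Proof.
apply/maxser_leP/andP => [/ser_add_cle[? ?]|[/maxser_leP ? /maxser_leP ?]].
  by split; apply/maxser_leP.
exact/ser_add_cle.
Qed.

HB.instance Definition _ := Order.POrder_MeetJoin_isLattice.Build
  maxser_display maxser maxser_lexI maxser_leUx.

(* Compatibility of the operations with the passage to the quotient. *)
Lemma canon_sum (s t : int -> zmax) : canon (sum_coef s t) = canon s + canon t.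
Proof.
apply: cle_eq => c; rewrite ser_add_cle !canon_cle; split=> [H|[H1 H2] k].
  by split=> k; have := H k; rewrite /sum_coef ge_max => /andP[].
by rewrite /sum_coef ge_max H1 H2.
Qed.

Lemma canon_cauchy (s t : int -> zmax) :
  canon (cauchy_coef s t) = canon s * canon t.
Proof.
have flip (f g : int -> zmax) (c : maxser) :
    (forall i j, (f i + g j <= c (i + j)%R)%E) ->
    (forall i j, (g i + f j <= c (i + j)%R)%E).
  by move=> H i j; rewrite addeC [(i + j)%R]addrC; exact: H.
apply: cle_eq => c; rewrite ser_mul_cle canon_cle cauchy_le.
split=> H.
  by apply/canon_add_le; apply/flip/canon_add_le/flip.
by move: H => /canon_add_le/flip/canon_add_le/flip.
Qed.

Lemma monomialD (t : zmax) (n1 n2 : int) :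
  monomial t n1 + monomial t n2 = monomial t (Order.min n1 n2).
Proof.
apply: cle_eq => c; rewrite ser_add_cle !monomial_cle.
split=> [[H1 H2]|H]; first by rewrite /Order.min; case: ifP.
by split; apply: (le_trans H); apply: coef_nd; rewrite ge_min lexx ?orbT.
Qed.

Lemma ser_sum_le (F : set maxser) (c : maxser) :
  (ser_sum F <= c)%O <-> (forall a, F a -> (a <= c)%O).
Proof.
split=> [/maxser_leP/ser_sum_cle H a Fa|H]; first exact/maxser_leP/H.
by apply/maxser_leP/ser_sum_cle => a Fa; exact/maxser_leP/H.
Qed.

Lemma ser_sum_mulr_le (F : set maxser) (b c : maxser) :
  (ser_sum F * b <= c)%O <-> (forall a, F a -> (a * b <= c)%O).
Proof.
split=> [/maxser_leP/ser_mul_sum H a Fa|H]; first exact/maxser_leP/H.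
by apply/maxser_leP/ser_mul_sum => a Fa; exact/maxser_leP/H.
Qed.

Definition mxle (m n : nat) (X Y : 'M[maxser]_(m, n)) : Prop :=
  forall i j, (X i j <= Y i j)%O.

Definition mxmeet (m n : nat) (X Y : 'M[maxser]_(m, n)) : 'M[maxser]_(m, n) :=
  \matrix_(i, j) (X i j `&` Y i j)%O.

Definition mxstar (n : nat) (M : 'M[maxser]_n) : 'M[maxser]_n :=
  \matrix_(i, j) ser_sum (range (fun k : nat => (M ^+ k) i j)).

(* The sum of all X with X Q <= P; that it is the greatest such X is
   [rresidP] below. *)
Definition rresid (n m q : nat) (P : 'M[maxser]_(n, q)) (Q : 'M[maxser]_(m, q)) :
    'M[maxser]_(n, m) :=
  \matrix_(i, j) ser_sum [set X i j | X in
    [set X : 'M[maxser]_(n, m) | mxle (X *m Q) P]].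

Definition least_solution (m n : nat) (f : 'M[maxser]_(m, n) -> 'M[maxser]_(m, n))
    (x : 'M[maxser]_(m, n)) : Prop :=
  x = f x /\ forall z, z = f z -> mxle x z.

Definition column_selection (m n : nat) (M : 'M[maxser]_(m, n)) : Prop :=
  (forall j, (exists! i, M i j = 1) /\ (forall i, M i j <> 1 -> M i j = 0)) /\
  (forall i j j', M i j = 1 -> M i j' = 1 -> j = j').

Definition row_selection (m n : nat) (M : 'M[maxser]_(m, n)) : Prop :=
  (forall i, (exists! j, M i j = 1) /\ (forall j, M i j <> 1 -> M i j = 0)) /\
  (forall j i i', M i j = 1 -> M i' j = 1 -> i = i').

Lemma maxser_sum_le (I : finType) (F : I -> maxser) (c : maxser) :
  (\sum_i F i <= c)%O <-> (forall i, (F i <= c)%O).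
Proof.
split=> [H i|H]; first by move: H; rewrite (bigD1 i) //= maxser_leUx => /andP[].
elim/big_ind: _ => //; last by move=> x y; rewrite maxser_leUx => -> ->.
by apply/maxser_leP; exact: ser0_cle.
Qed.

Lemma mulmx_le (m n q : nat) (X : 'M[maxser]_(m, n)) (Y : 'M_(n, q)) i j c :
  ((X *m Y) i j <= c)%O <-> (forall k, (X i k * Y k j <= c)%O).
Proof. by rewrite mxE maxser_sum_le. Qed.

Lemma mxle_anti (m n : nat) (X Y : 'M[maxser]_(m, n)) :
  mxle X Y -> mxle Y X -> X = Y.
Proof. by move=> XY YX; apply/matrixP => i j; apply/le_anti; rewrite XY YX. Qed.

Lemma rresidP (n m q : nat) (P : 'M[maxser]_(n, q)) (Q : 'M[maxser]_(m, q)) :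
  mxle (rresid P Q *m Q) P /\
  (forall X, mxle (X *m Q) P -> mxle X (rresid P Q)).
Proof.
split=> [i j|X XP i j].
  apply/mulmx_le => k; rewrite mxE; apply/ser_sum_mulr_le => _ [X /= XP <-].
  exact: (mulmx_le _ _ _ _ _).1 (XP i j) k.
by rewrite mxE; apply: (ser_sum_le _ _).1 => //; exists X.
Qed.

Lemma mxstar_least (n q : nat) (M : 'M[maxser]_n) (b : 'M[maxser]_(n, q)) :
  least_solution (fun x => M *m x + b) (mxstar M *m b).
Proof.
have leS i j c : (mxstar M i j <= c)%O <-> (forall k, ((M ^+ k) i j <= c)%O).
  rewrite mxE ser_sum_le; split=> [H k|H _ [k _ <-] //].
  by apply: H; exists k.
have starE : mxstar M = M *m mxstar M + 1%:M.
  have mulSle i j c : ((M *m mxstar M) i j <= c)%O <->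
      (forall k, ((M ^+ k.+1) i j <= c)%O).
    split=> [/mulmx_le H k|H].
      rewrite exprS; apply/mulmx_le => l; apply: le_trans (H l).
      rewrite mulrC [X in (_ <= X)%O]mulrC [mxstar M l j]mxE.
      by apply: (ser_sum_mulr_le _ _ _).1 => //; exists k.
    apply/mulmx_le => l; rewrite mulrC [mxstar M l j]mxE.
    apply/ser_sum_mulr_le => _ [k _ <-]; rewrite mulrC.
    by have := H k; rewrite exprS => /mulmx_le.
  apply: mxle_anti => i j.
    apply/leS => k; rewrite mxE.
    have := lexx ((M *m mxstar M) i j + (1%:M : 'M[maxser]_n) i j).
    rewrite maxser_leUx => /andP[/mulSle H1 H2].
    by case: k => [|k]; [exact: H2|exact: H1].
  rewrite [X in (X <= _)%O]mxE maxser_leUx; apply/andP; split.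
    by apply/mulSle => k; move: (leS i j (mxstar M i j)) => -[/(_ (lexx _)) + _]; apply.
  by move: (leS i j (mxstar M i j)) => -[/(_ (lexx _) 0%N) + _].
split=> [|z zE i j]; first by rewrite {1}starE mulmxDl mul1mx mulmxA.
have zle k : mxle (M ^+ k *m b) z.
  have Mz_b i' j' : ((M *m z) i' j' <= z i' j')%O /\ (b i' j' <= z i' j')%O.
    have : ((M *m z + b) i' j' <= z i' j')%O by rewrite -zE.
    by rewrite mxE maxser_leUx => /andP[].
  elim: k => [|k IH] i' j'; first by rewrite expr0 mul1mx; case: (Mz_b i' j').
  rewrite exprS -mulmxA; apply/mulmx_le => l.
  apply: le_trans ((mulmx_le _ _ _ _ _).1 (Mz_b i' j').1 l).
  apply/maxser_leP/ser_mul_cle => p r; apply: le_trans.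
    by apply: leeD; [exact: lexx|exact: (elimT (maxser_leP _ _) (IH l j'))].
  exact: (ser_mul_cle _ _ _).1 (fun=> lexx _) p r.
apply/mulmx_le => l; rewrite mxE; apply/ser_sum_mulr_le => _ [k _ <-].
exact: (mulmx_le _ _ _ _ _).1 (zle k i j) l.
Qed.

(* The two implicit equations defining the state and the observer do have least
   solutions, and the least state is A^* B u + A^* R w. *)
Lemma state_least (n p l q : nat) (A : 'M[maxser]_n)
    (B : 'M_(n, p)) (R : 'M_(n, l)) (u : 'M_(p, q)) (w : 'M_(l, q)) :
  least_solution (fun v => A *m v + B *m u + R *m w)
    (mxstar A *m B *m u + mxstar A *m R *m w).
Proof.
have -> : (fun v => A *m v + B *m u + R *m w) =
    (fun v : 'M_(n, q) => A *m v + (B *m u + R *m w)).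
  by apply/funext => v; rewrite addrA.
by rewrite -!mulmxA -mulmxDr; exact: mxstar_least.
Qed.

Lemma observer_least (n p m q : nat) (A : 'M[maxser]_n) (B : 'M_(n, p))
    (C : 'M_(m, n)) (L : 'M_(n, m)) (u : 'M_(p, q)) (y : 'M_(m, q)) :
  least_solution (fun v => A *m v + B *m u + L *m (C *m v + y))
    (mxstar (A + L *m C) *m (B *m u + L *m y)).
Proof.
have -> : (fun v => A *m v + B *m u + L *m (C *m v + y)) =
    (fun v : 'M_(n, q) => (A + L *m C) *m v + (B *m u + L *m y)).
  by apply/funext => v; rewrite mulmxDl mulmxDr mulmxA addrACA.
exact: mxstar_least.
Qed.

(* Main.v *)
Require Import Defs.
From HB Require Import structures.
From mathcomp Require Import all_boot all_order all_algebra.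

Set Implicit Arguments.
Unset Strict Implicit.
Unset Printing Implicit Defensive.

Import GRing.Theory.
Local Open Scope ring_scope.

(* By residuation L_x C A^* B <= A^* B and L_x C A^* R <= A^* R, and the given z
   lies below both residuals, so both inequalities are equalities and
   L_x C x = x. Hence x is a fixed point of the observer equation, while every
   fixed point dominates L_x y = L_x C x = x. *)

(** The order of series is by definition the test [b == b + a]. This form turns inequalities into
    equations open to rewriting. *)
Lemma mxleP (m n : nat) (X Y : 'M[maxser]_(m, n)) : mxle X Y <-> Y = Y + X.
Proof.
split=> [XY|YE i j]; last by apply/eqP; rewrite {1}YE mxE.
by apply/matrixP => i j; rewrite mxE; apply/eqP; exact: XY.
Qed.

Lemma mxaddxx (m n : nat) (X : 'M[maxser]_(m, n)) : X + X = X.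
Proof. by apply/esym/mxleP => i j. Qed.

Lemma mxle_trans (m n : nat) (Y X Z : 'M[maxser]_(m, n)) :
  mxle X Y -> mxle Y Z -> mxle X Z.
Proof. by move=> XY YZ i j; exact: Order.POrderTheory.le_trans (XY i j) (YZ i j). Qed.

(** Distributivity carries [Y = Y + X] through the product. *)
Lemma mxle_mull (m n q : nat) (X Y : 'M[maxser]_(m, n)) (Z : 'M_(n, q)) :
  mxle X Y -> mxle (X *m Z) (Y *m Z).
Proof. by move=> /mxleP XY; apply/mxleP; rewrite -mulmxDl -XY. Qed.

Lemma mxle_meet (m n : nat) (X Y Z : 'M[maxser]_(m, n)) :
  mxle Z (mxmeet X Y) <-> mxle Z X /\ mxle Z Y.
Proof.
split=> [H|[ZX ZY] i j]; last by rewrite mxE maxser_lexI ZX ZY.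
by split=> i j; have := H i j; rewrite mxE maxser_lexI => /andP[].
Qed.

(** Squeeze: [P = z *m Q <= L *m Q <= rresid P Q *m Q <= P]. Taking [L] merely between [z] and the
    residual lets the same [Lx] serve for both [B] and [R]. *)
Lemma eq_mul_below_rresid (n m q : nat) (P : 'M[maxser]_(n, q))
    (Q : 'M[maxser]_(m, q)) (z L : 'M[maxser]_(n, m)) :
  P = z *m Q -> mxle z L -> mxle L (rresid P Q) -> L *m Q = P.
Proof.
move=> PE zL LP; apply: mxle_anti.
  by apply: mxle_trans (rresidP P Q).1; exact: mxle_mull.
by rewrite {1}PE; exact: mxle_mull.
Qed.

Theorem proposition4 (n p m l : nat)
    (A : 'M[maxser]_n) (B : 'M[maxser]_(n, p))
    (C : 'M[maxser]_(m, n)) (R : 'M[maxser]_(n, l))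
    (hB : column_selection B) (hR : column_selection R)
    (hC : row_selection C) :
  let Bbar : 'M[maxser]_(n, p + l) := row_mx B R in
  let Lx : 'M[maxser]_(n, m) :=
    mxmeet (rresid (mxstar A *m B) (C *m mxstar A *m B))
           (rresid (mxstar A *m R) (C *m mxstar A *m R)) in
  (exists z : 'M[maxser]_(n, m),
     mxstar A *m Bbar = z *m (C *m mxstar A *m Bbar)) ->
  forall (u : 'cV[maxser]_p) (w : 'cV[maxser]_l),
  let x : 'cV[maxser]_n := mxstar A *m B *m u + mxstar A *m R *m w in
  let y : 'cV[maxser]_m := C *m x in
  forall xhat : 'cV[maxser]_n,
    least_solution
      (fun v : 'cV[maxser]_n => A *m v + B *m u + Lx *m (C *m v + y)) xhat ->
    xhat = x.
Proof.
move=> Bbar Lx [z zBbar] u w x y xhat [xhatE xhat_least].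
(* The same [z] factors both blocks, so it lies below both residuals and hence below their meet
   [Lx]. *)
move: zBbar; rewrite /Bbar !mul_mx_row => /eq_row_mx[zB zR].
have [LB LR] : mxle Lx (rresid (mxstar A *m B) (C *m mxstar A *m B)) /\
    mxle Lx (rresid (mxstar A *m R) (C *m mxstar A *m R)).
  by apply/mxle_meet => i j.
have zL : mxle z Lx.
  by apply/mxle_meet; split; apply: (rresidP _ _).2; rewrite -?zB -?zR => i j.
have Ly : Lx *m y = x.
  rewrite /y {1}/x !mulmxDr !mulmxA -(mulmxA Lx C) -!(mulmxA Lx).
  by rewrite (mulmxA Lx _ u) (mulmxA Lx _ w)
    (eq_mul_below_rresid zB zL LB) (eq_mul_below_rresid zR zL LR).
have xE : x = A *m x + B *m u + R *m w := (state_least A B R u w).1.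
apply: mxle_anti.
  (* By minimality it suffices that [x] is a fixed point; since [Lx *m y = x], this reduces to
     [x = A *m x + B *m u + x], and the state equation absorbs the repeated terms. *)
  apply: xhat_least; rewrite mulmxDr Ly mxaddxx.
  by rewrite {3}xE addrA mxaddxx -xE.
(* The term [Lx *m y] makes [x] a summand of [xhat], which by idempotency gives [x <= xhat]. *)
have xhatLE : xhat = A *m xhat + B *m u + Lx *m (C *m xhat) + x.
  by rewrite {1}xhatE mulmxDr Ly addrA.
by apply/mxleP; rewrite {2}xhatLE -addrA mxaddxx.
Qed.
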